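(* Let $T$ be a tree with diameter at most three. Then $-1$ is an eigenvalue of the distance matrix $D(T)$ if and only if $T\cong P_2$ or $T\cong S_{2,2}$.
   Context: For a connected graph $G$ with vertices $v_1,\ldots,v_n$, the distance matrix $D(G)$ is the $n\times n$ real symmetric matrix whose $(i,j)$-entry is the length of a shortest path from $v_i$ to $v_j$. $P_2$ is the path on two vertices. The double star $S_{a,b}$ is the tree obtained by attaching $a$ and $b$ pendant vertices, respectively, to the two end vertices of $K_2$; thus $S_{2,2}$ has six vertices. *)

(* Defs.v *)
From HB Require Import structures.
From mathcomp Require Import all_boot all_order all_algebra.
From mathcomp Require Import reals.

Set Implicit Arguments.
Unset Strict Implicit.
Unset Printing Implicit Defensive.

Import GRing.Theory.

Record sgraph := SGraph {
  vertex :> finType;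
  adj : rel vertex;
  adj_sym : symmetric adj;
  adj_irrefl : irreflexive adj }.

Definition isomorphic (G H : sgraph) : Prop :=
  exists2 f : G -> H, bijective f & forall x y, adj (f x) (f y) = adj x y.

(* [x :: p] is a path (without repeated vertices) from [x] to [y];
   its length is [size p]. *)
Definition is_path (G : sgraph) (x y : G) (p : seq G) : bool :=
  [&& path (@adj G) x p, last x p == y & uniq (x :: p)].

(* The least [k < #|G|] such that some path from [x] to [y] has length [k].
   Every path has length less than [#|G|], so the bound loses nothing; the
   value is the junk [#|G|] when there is no path, i.e. only if [G] is
   disconnected. *)
Definition dist (G : sgraph) (x y : G) : nat :=
  find (fun k => [exists p : k.-tuple G, is_path x y p]) (iota 0 #|G|).

Definition diameter (G : sgraph) : nat := \max_(x : G) \max_(y : G) dist x y.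

Definition connected (G : sgraph) : Prop :=
  0 < #|G| /\ forall x y : G, connect (@adj G) x y.

(* [ucycle] also accepts [:: x; y] when [x] and [y] are adjacent, so the cycles
   of a simple graph are those with at least three vertices. *)
Definition acyclic (G : sgraph) : Prop :=
  forall c : seq G, ucycle (@adj G) c -> size c <= 2.

Definition is_tree (G : sgraph) : Prop := connected G /\ acyclic G.

(* The vertices are numbered [v_i := enum_val i]. *)
Definition distance_matrix (R : realType) (G : sgraph) : 'M[R]_#|G| :=
  (\matrix_(i, j) (dist (enum_val i) (enum_val j))%:R)%R.

Definition path_adj n : rel 'I_n := fun i j => (i.+1 == j) || (j.+1 == i).

Lemma path_adj_sym n : symmetric (@path_adj n).
Proof. by move=> i j; rewrite /path_adj orbC. Qed.

Lemma path_adj_irrefl n : irreflexive (@path_adj n).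
Proof. by move=> i; rewrite /path_adj orbb gtn_eqF. Qed.

Definition path_graph n : sgraph :=
  SGraph (@path_adj_sym n) (@path_adj_irrefl n).

(* [inl false] and [inl true] are the two vertices of K_2, carrying
   respectively the [a] and the [b] pendant vertices. *)
Definition double_star_adj a b : rel (bool + ('I_a + 'I_b)) := fun u v =>
  match u, v with
  | inl c, inl d => c != d
  | inl c, inr (inl _) | inr (inl _), inl c => c == false
  | inl c, inr (inr _) | inr (inr _), inl c => c == true
  | inr _, inr _ => false
  end.

Lemma double_star_adj_sym a b : symmetric (@double_star_adj a b).
Proof. by move=> [c|[i|i]] [d|[j|j]] //=; rewrite eq_sym. Qed.

Lemma double_star_adj_irrefl a b : irreflexive (@double_star_adj a b).
Proof. by move=> [c|[i|i]] //=; rewrite eqxx. Qed.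

Definition double_star a b : sgraph :=
  SGraph (@double_star_adj_sym a b) (@double_star_adj_irrefl a b).

(* Main.v *)
Require Import Defs.
From mathcomp Require Import all_boot all_order all_algebra.
From mathcomp Require Import reals.
From mathcomp Require Import ring lra zify.

(** In a tree, paths between two given vertices are unique
    ([acyclic_unique_path]), so the length of any path that can be exhibited is
    the distance ([acyclic_dist]).

    A tree [T] with an edge and of diameter at most three is a double star
    [S_(a,b)], where [a] and [b] may vanish: [a = b = 0] gives P_2 and exactly
    one vanishing parameter gives a star.  The two centres are the ends of an
    edge [uv] for which the set of vertices adjacent to [u] or to [v] is
    largest.  If some vertex were missed, connectedness would give a missed
    vertex [w] with a neighbour [z] adjacent to [u], say.  The path [w z u v]
    cannot be extended beyond [v], because that would make a distance of four;
    so [v] is pendant, and the edge [uz] beats [uv] ([edge_nbhd_improve]).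

    On [S_(a,b)], let [w] satisfy the eigenvector equations for [-1], let [P]
    and [Q] be its values at the two centres, and let [A] and [B] be its sums
    over the pendant vertices at each of them.  The equations at the centres
    say that [A = B] and [P + Q = -3 A].  Those at the pendant vertices say
    that [w] is the constant [Q + 2 A] on the first group and [P + 2 A] on the
    second, whence [A = a (Q + 2 A)] and [A = b (P + 2 A)].  If [A = 0], then
    [w] vanishes unless [a = b = 0].  Otherwise, multiplying these equations by
    [b] and [a] and adding them gives [(a + b) A = a b (P + Q + 4 A) = a b A],
    that is, [a + b = a b], whose only positive solution is [a = b = 2]
    ([double_star_eigen]).  A tree without an edge is a single vertex, whose
    distance matrix is zero. *)

Set Implicit Arguments.
Unset Strict Implicit.
Unset Printing Implicit Defensive.

Import GRing.Theory Num.Theory.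

(** * Paths and distances in acyclic graphs *)

Section Acyclic.
Variables (G : sgraph) (acyclic_G : acyclic G).

Lemma acyclic_no_triangle (x y z : G) :
  adj x y -> adj y z -> adj z x -> False.
Proof.
move=> xy yz zx; suff /acyclic_G : ucycle (@adj G) [:: x; y; z] by [].
rewrite /ucycle /= xy yz zx /= !inE.
case: (eqVneq x y) xy => [->|_ _]; first by rewrite adj_irrefl.
case: (eqVneq x z) zx => [->|_ _]; first by rewrite adj_irrefl.
by case: (eqVneq y z) yz => [->|_ _]; first by rewrite adj_irrefl.
Qed.

Lemma acyclic_no_square (x y z t : G) :
  adj x y -> adj y z -> adj z t -> adj t x -> x != z -> y != t -> False.
Proof.
move=> xy yz zt tx x_z y_t.
suff /acyclic_G : ucycle (@adj G) [:: x; y; z; t] by [].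
rewrite /ucycle /= xy yz zt tx /= !inE (negbTE x_z) (negbTE y_t) /= orbF.
case: (eqVneq x y) xy => [->|_ _]; first by rewrite adj_irrefl.
case: (eqVneq x t) tx => [->|_ _]; first by rewrite adj_irrefl.
case: (eqVneq y z) yz => [->|_ _]; first by rewrite adj_irrefl.
by case: (eqVneq z t) zt => [->|_ _]; first by rewrite adj_irrefl.
Qed.

(** A path from [a] to [b] that avoids their common neighbour [x] closes up,
    through [x], into a cycle with at least three vertices if [a] and [b]
    differ. *)
Lemma acyclic_separated (x a b : G) :
  adj x a -> adj x b ->
  connect [rel y z | [&& adj y z, y != x & z != x]] a b -> a = b.
Proof.
move=> xa xb /connectP[p0 p0P b_last].
case: (shortenP p0P) b_last => p pP uniq_p _ b_last {p0 p0P}.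
case: p pP uniq_p b_last => [_ _ -> //|c p] pP uniq_p b_last.
suff /acyclic_G : ucycle (@adj G) [:: x, a, c & p] by [].
have x_notin : x \notin [:: a, c & p].
  have x_cp : x \notin c :: p.
    rewrite -has_pred1 -all_predC.
    elim: (c :: p) (a) pP => //= d q IHq e /andP[/and3P[_ _ ->] /IHq].
    exact.
  rewrite inE negb_or x_cp andbT.
  by apply: contraTneq xa => ->; rewrite adj_irrefl.
rewrite /ucycle cons_uniq x_notin uniq_p andbT /cycle rcons_path.
rewrite [last _ _]/= -[last c p]/(last a (c :: p)) -b_last adj_sym xb andbT.
rewrite -[path _ _ _]/(adj x a && path (@adj G) a (c :: p)) xa andbT; move: pP.
by apply: (@sub_path _ _ (@adj G)) => y z /= /and3P[].
Qed.

(** If two paths leave [x] through different vertices [a] and [b], then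
    following the first to the common end and coming back along the second
    joins [a] to [b] without meeting [x]. *)
Lemma acyclic_unique_path (x y : G) (p q : seq G) :
  is_path x y p -> is_path x y q -> p = q.
Proof.
elim: p x q => [|a p IHp] x [|b q] //.
- move=> /and3P[_ /= /eqP <- _] /and3P[_ /= /eqP last_x].
  by rewrite -{1}last_x mem_last.
- move=> /and3P[_ /= /eqP <- /andP[x_ap _]] /and3P[_ /= /eqP x_last _].
  by rewrite x_last mem_last in x_ap.
move=> /and3P[/= /andP[xa ap] /eqP la /andP[x_ap uniq_ap]].
move=> /and3P[/= /andP[xb bq] /eqP lb /andP[x_bq uniq_bq]].
suff eq_ab : a = b.
  congr (_ :: _) => //; apply: (IHp a).
    by rewrite /is_path ap la eqxx.
  by rewrite eq_ab /is_path bq lb eqxx.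
apply: (acyclic_separated xa xb).
set e := [rel _ _ | _].
have to_last c s :
    path (@adj G) c s -> x \notin c :: s -> connect e c (last c s).
  move=> cs x_cs; apply/connectP; exists s => //.
  elim: s c cs x_cs => //= d s IHs c /andP[cd ds].
  rewrite inE negb_or => /andP[x_c x_ds].
  rewrite cd eq_sym x_c IHs // andbT eq_sym /=.
  by move: x_ds; rewrite inE negb_or => /andP[].
apply: (@connect_trans _ e y); first by rewrite -la to_last.
rewrite (@sym_connect_sym _ e); first by rewrite -lb to_last.
by move=> c d /=; rewrite adj_sym (andbC (c != x)).
Qed.

Lemma acyclic_dist (x y : G) (p : seq G) :
  is_path x y p -> dist x y = size p.
Proof.
move=> xyp; rewrite /dist; set P := fun k => _.
have PE k : P k = (k == size p).
  apply/existsP/eqP => [[q /(acyclic_unique_path xyp) ->]|->].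
    by rewrite size_tuple.
  by exists (in_tuple p).
have size_p : size p < #|G|.
  by case/and3P: xyp => _ _ /card_uniqP /= <-; apply: max_card.
have hasP : has P (iota 0 #|G|).
  by apply/hasP; exists (size p); rewrite ?mem_iota ?PE.
have := nth_find 0 hasP; rewrite PE nth_iota; first by move/eqP.
by rewrite has_find size_iota in hasP.
Qed.

End Acyclic.

Lemma dist_diameter (G : sgraph) (x y : G) : dist x y <= diameter G.
Proof.
by rewrite /diameter (bigD1 x) //= (bigD1 y) //= -maxnA leq_maxl.
Qed.

(** * Isomorphisms *)

Lemma isomorphic_sym (G H : sgraph) : isomorphic G H -> isomorphic H G.
Proof.
case=> f [g fK gK] f_adj; exists g; first by exists f.
by move=> x y; rewrite -f_adj !gK.
Qed.

Lemma isomorphic_trans (G H K : sgraph) :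
  isomorphic G H -> isomorphic H K -> isomorphic G K.
Proof.
move=> [f f_bij f_adj] [g g_bij g_adj]; exists (g \o f); first exact: bij_comp.
by move=> x y /=; rewrite g_adj f_adj.
Qed.

Lemma path2_double_star : isomorphic (path_graph 2) (double_star 0 0).
Proof.
pose f (i : path_graph 2) : double_star 0 0 := inl (val i == 1).
have f_inj : injective f.
  by move=> [[|[|//]] ?] [[|[|//]] ?] // _; apply: val_inj.
exists f.
  by apply: (inj_card_bij f_inj); rewrite !card_sum card_bool !card_ord.
by move=> [[|[|//]] ?] [[|[|//]] ?].
Qed.

(** * Trees of diameter at most three *)

Section Cover.
Variables (T : sgraph) (tree_T : is_tree T) (diam_T : diameter T <= 3).

(** When [u] and [v] are adjacent, this set contains both of them. *)
Definition edge_nbhd (u v : T) : {set T} := [set x | adj u x || adj v x].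

(** No path [w z u v y] exists, as its ends would be at distance four; so [u] is
    the only neighbour of [v].  Going from [uv] to [uz] then loses no vertex,
    since [u] is adjacent to [z], and gains [w]. *)
Lemma edge_nbhd_improve (u v z w : T) :
  adj u v -> adj u z -> adj z w -> w \notin edge_nbhd u v ->
  #|edge_nbhd u v| < #|edge_nbhd u z|.
Proof.
have [_ acyc] := tree_T.
move=> uv uz zw; rewrite inE negb_or => /andP[uw vw].
have vE y : adj v y -> y = u.
  move=> vy; apply/eqP/negP => /negP y_u.
  suff wy : is_path w y [:: z; u; v; y].
    have := leq_trans (dist_diameter w y) diam_T.
    by rewrite (acyclic_dist acyc wy).
  rewrite /is_path /= adj_sym zw adj_sym uz uv vy eqxx /= !inE !negb_or.
  have ne (s t r : T) : adj r s -> ~~ adj r t -> s != t.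
    by move=> rs rt; apply: contra rt => /eqP <-.
  have ne_adj (s t : T) : adj s t -> s != t.
    by move=> st; apply: contraTneq st => ->; rewrite adj_irrefl.
  have wz : adj w z by rewrite adj_sym.
  have zu : adj z u by rewrite adj_sym.
  have vu : adj v u by rewrite adj_sym.
  have -> : w != z by apply: ne_adj.
  have -> : w != u by rewrite eq_sym; apply: ne vu vw.
  have -> : w != v by rewrite eq_sym; apply: ne uv uw.
  have -> : w != y by rewrite eq_sym; apply: ne vy vw.
  have -> : z != u by apply: ne_adj.
  have -> : z != v by apply: contraNneq vw => <-.
  have -> : z != y.
    apply/negP => /eqP zy; apply: (acyclic_no_triangle acyc uv vy).
    by rewrite -zy.
  by rewrite (eq_sym u y) y_u !ne_adj.
apply: proper_card; apply/properP; split; last first.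
  by exists w; rewrite !inE ?zw ?orbT // negb_or uw.
apply/subsetP => y; rewrite !inE => /orP[->//|/vE ->].
by rewrite (adj_sym z) uz orbT.
Qed.

(** For an edge [uv] with the largest [edge_nbhd], that set is closed under
    adjacency, by [edge_nbhd_improve] applied to [uv] or to [vu]; so it contains
    every vertex of the connected graph [T]. *)
Lemma edge_cover (u0 v0 : T) : adj u0 v0 ->
  exists u v : T, adj u v /\ forall x, adj u x || adj v x.
Proof.
move=> uv0; have [[_ conn] _] := tree_T.
pose P (e : T * T) := adj e.1 e.2.
case: (@arg_maxnP _ (u0, v0) P (fun e => #|edge_nbhd e.1 e.2|) uv0).
move=> [u v]; rewrite /P /= => uv max_uv; exists u, v; split=> //.
have nbhdC s t : edge_nbhd s t = edge_nbhd t s.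
  by apply/setP => x; rewrite !inE orbC.
have closed_uv : closed (@adj T) (edge_nbhd u v).
  apply: intro_closed; first by apply: sym_connect_sym; apply: adj_sym.
  move=> z w zw; rewrite inE; apply: contraLR => w_out.
  apply/norP; split; apply/negP => adj_z.
    have := edge_nbhd_improve uv adj_z zw w_out.
    by rewrite ltnNge (max_uv (u, z)).
  have vu : adj v u by rewrite adj_sym.
  rewrite nbhdC in w_out; have := edge_nbhd_improve vu adj_z zw w_out.
  by rewrite nbhdC ltnNge (max_uv (v, z)).
move=> x; have := closed_connect closed_uv (conn v x).
by rewrite !inE uv /= => <-.
Qed.

(** The pendant vertices are the neighbours of [u] other than [v] and those of
    [v] other than [u].  These sets are disjoint and no edge lies inside either
    of them because there are no triangles; no edge joins one to the other
    because there are no squares. *)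
Lemma small_tree_double_star (u0 v0 : T) : adj u0 v0 ->
  exists a b, isomorphic T (double_star a b).
Proof.
have [_ acyc] := tree_T.
move=> /edge_cover[u [v [uv cover]]].
pose A := [set x | adj u x] :\ v; pose B := [set x | adj v x] :\ u.
have vu : adj v u by rewrite adj_sym.
have AP x : x \in A -> [/\ x != u, x != v, adj u x & ~~ adj v x].
  rewrite !inE => /andP[-> ux]; rewrite ux; split=> //.
    by apply: contraTneq ux => ->; rewrite adj_irrefl.
  by apply/negP => vx; apply: (acyclic_no_triangle acyc uv vx); rewrite adj_sym.
have BP x : x \in B -> [/\ x != u, x != v, adj v x & ~~ adj u x].
  rewrite !inE => /andP[-> vx]; rewrite vx; split=> //.
    by apply: contraTneq vx => ->; rewrite adj_irrefl.
  by apply/negP => ux; apply: (acyclic_no_triangle acyc uv vx); rewrite adj_sym.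
pose g (s : double_star #|A| #|B|) : T := match s with
  | inl c => if c then v else u
  | inr (inl i) => enum_val i
  | inr (inr j) => enum_val j
  end.
have u_v : u != v by apply: contraTneq uv => ->; rewrite adj_irrefl.
have gA (i : 'I_#|A|) := AP _ (enum_valP i).
have gB (i : 'I_#|B|) := BP _ (enum_valP i).
exists #|A|, #|B|; apply: isomorphic_sym; exists g; last first.
  have triangle (c x y : T) : adj c x -> adj c y -> adj x y = false.
    move=> cx cy; apply/negP => xy.
    by apply: (acyclic_no_triangle acyc cx xy); rewrite adj_sym.
  have square (x y : T) :
      adj u x -> x != v -> adj v y -> y != u -> adj x y = false.
    move=> ux x_v vy y_u; apply/negP => xy.
    apply: (acyclic_no_square acyc ux xy _ vu); rewrite // 1?adj_sym //.
    by rewrite eq_sym.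
  move=> [[]|[i|i]] [[]|[j|j]]; rewrite [LHS]/= [RHS]/= ?adj_irrefl //.
  - by case: (gA j) => _ _ _ /negbTE.
  - by case: (gB j).
  - by case: (gA j).
  - by case: (gB j) => _ _ _ /negbTE.
  - by rewrite adj_sym; case: (gA i) => _ _ _ /negbTE.
  - by rewrite adj_sym; case: (gA i).
  - by case: (gA i) (gA j) => _ _ ux _ [_ _ uy _]; apply: triangle ux uy.
  - by case: (gA i) (gB j) => _ x_v ux _ [y_u _ vy _]; apply: square.
  - by rewrite adj_sym; case: (gB i).
  - by rewrite adj_sym; case: (gB i) => _ _ _ /negbTE.
  - rewrite adj_sym.
    by case: (gA j) (gB i) => _ x_v ux _ [y_u _ vy _]; apply: square.
  - by case: (gB i) (gB j) => _ _ ux _ [_ _ uy _]; apply: triangle ux uy.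
have g_inj : injective g.
  have AB (i : 'I_#|A|) (j : 'I_#|B|) : (enum_val i == enum_val j) = false.
    case: (gA i) (gB j) => _ _ ux _ [_ _ _ uy].
    by apply: contraNF uy => /eqP <-.
  have Au (i : 'I_#|A|) : (enum_val i == u) = false.
    by case: (gA i) => /negbTE.
  have Av (i : 'I_#|A|) : (enum_val i == v) = false.
    by case: (gA i) => _ /negbTE.
  have Bu (i : 'I_#|B|) : (enum_val i == u) = false.
    by case: (gB i) => /negbTE.
  have Bv (i : 'I_#|B|) : (enum_val i == v) = false.
    by case: (gB i) => _ /negbTE.
  have diff := (Au, Av, Bu, Bv, AB, negbTE u_v).
  move=> [[]|[i|i]] [[]|[j|j]] // /eqP; rewrite /g;
    first [by rewrite diff | by rewrite eq_sym diff
          | by move=> /eqP /enum_val_inj ->].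
apply: (inj_card_bij g_inj).
rewrite -(card_codom g_inj); apply: subset_leq_card; apply/subsetP => x _.
apply/codomP; have [->|x_u] := eqVneq x u; first by exists (inl false).
have [->|x_v] := eqVneq x v; first by exists (inl true).
case/orP: (cover x) => [ux|vx].
  have xA : x \in A by rewrite !inE x_v.
  by exists (inr (inl (enum_rank_in xA x))); rewrite /g enum_rankK_in.
have xB : x \in B by rewrite !inE x_u.
by exists (inr (inr (enum_rank_in xB x))); rewrite /g enum_rankK_in.
Qed.

End Cover.

(** * Distances in double stars *)

Lemma is_path_map (G H : sgraph) (f : G -> H) (x y : G) (p : seq G) :
  injective f -> (forall s t, adj (f s) (f t) = adj s t) ->
  is_path x y p -> is_path (f x) (f y) (map f p).
Proof.
move=> f_inj f_adj /and3P[xp /eqP <- uniq_p]; apply/and3P; split.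
- by rewrite path_map; apply: sub_path xp => s t; rewrite /= f_adj.
- by rewrite last_map.
- by rewrite -map_cons map_inj_uniq.
Qed.

Section DoubleStarDist.
Variables (a b : nat).

(** The centre nearest to [s], which is [s] itself if [s] is a centre. *)
Definition hub (s : double_star a b) : bool := match s with
  | inl c => c
  | inr (inl _) => false
  | inr (inr _) => true
  end.

Definition pendant (s : double_star a b) : bool :=
  if s is inl _ then false else true.

(** A path between two distinct vertices steps to the centre of the first one if
    that is pendant, crosses the central edge if the centres differ, and steps
    out to the second one if that is pendant. *)
Definition ds_dist (s t : double_star a b) : nat :=
  if s == t then 0 else pendant s + (hub s != hub t) + pendant t.

Definition ds_path (s t : double_star a b) : seq (double_star a b) :=
  if s == t then [::] else
    nseq (pendant s) (inl (hub s)) ++ nseq (hub s != hub t) (inl (hub t)) ++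
    nseq (pendant t) t.

Lemma size_ds_path s t : size (ds_path s t) = ds_dist s t.
Proof.
rewrite /ds_path /ds_dist; case: eqP => // _.
by rewrite !size_cat !size_nseq addnA.
Qed.

Lemma ds_pathP s t : is_path s t (ds_path s t).
Proof.
rewrite /ds_path; have [->|s_t] := eqVneq s t.
  by rewrite /is_path /= eqxx.
by case: s t s_t => [[]|[i|i]] [[]|[j|j]] s_t;
  rewrite /is_path /= ?eqxx ?inE ?negb_or ?s_t.
Qed.

(** The distance is taken in a copy [G] of the double star, where acyclicity is
    a hypothesis and does not have to be proved. *)
Lemma double_star_dist (G : sgraph) (f : double_star a b -> G) :
  acyclic G -> injective f -> (forall s t, adj (f s) (f t) = adj s t) ->
  forall s t, dist (f s) (f t) = ds_dist s t.
Proof.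
move=> acyc f_inj f_adj s t; have := is_path_map f_inj f_adj (ds_pathP s t).
by move/(acyclic_dist acyc); rewrite size_map size_ds_path.
Qed.

End DoubleStarDist.

(** * The eigenvalue -1 *)

(** The equation reads [(a - 1) (b - 1) = 1] over the integers. *)
Lemma addn_eq_muln (a b : nat) :
  a + b = a * b -> a = 0 /\ b = 0 \/ a = 2 /\ b = 2.
Proof.
case: a => [|[|[|a]]]; [by left; lia | by lia | by right; lia |].
by case: b => [|[|b]]; nia.
Qed.

Section Spectrum.
Local Open Scope ring_scope.

(** Eigenvectors as functions on the vertices, which frees the equations from
    the numbering of the vertices. *)
Lemma eigenvalue_distance_matrix (R : realType) (G : sgraph) (c : R) :
  eigenvalue (distance_matrix R G) c <->
  exists w : G -> R, (exists x, w x != 0) /\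
    forall y, \sum_x w x * (dist x y)%:R = c * w y.
Proof.
split=> [/eigenvalueP[v vD v_neq0]|[w [[x wx] wD]]].
  exists (fun x => v 0 (enum_rank x)); split.
    have [i vi] := rV0Pn v v_neq0.
    by exists (enum_val i); rewrite enum_valK.
  move=> y; move/rowP/(_ (enum_rank y)): vD; rewrite !mxE => <-.
  rewrite (reindex (@enum_val _ G)) /=; last exact: (onW_bij _ (enum_val_bij G)).
  by apply: eq_bigr => i _; rewrite mxE enum_valK enum_rankK.
apply/eigenvalueP; exists (\row_i w (enum_val i)).
  apply/rowP => j; rewrite !mxE -wD (reindex (@enum_val _ G)) /=; last first.
    exact: (onW_bij _ (enum_val_bij G)).
  by apply: eq_bigr => i _; rewrite !mxE.
by apply/rV0Pn; exists (enum_rank x); rewrite mxE enum_rankK.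
Qed.

(** The distance formula for distinct vertices gives [2] instead of [0] for a
    pendant vertex and itself; the term [- 2 * w t] corrects this. *)
Lemma sum_ds_dist (R : comNzRingType) (a b : nat) (w : double_star a b -> R)
    (P := w (inl false)) (Q := w (inl true))
    (A := \sum_i w (inr (inl i))) (B := \sum_j w (inr (inr j))) t :
  \sum_s w s * (ds_dist s t)%:R =
  (if hub t then P + 2 * A + B else Q + A + 2 * B) +
  (pendant t)%:R * (P + Q + A + B - 2 * w t).
Proof.
have E s : w s * (ds_dist s t)%:R =
    w s * (pendant s + (hub s != hub t) + pendant t)%:R
    - (if s == t then 2 * (pendant t)%:R * w t else 0).
  rewrite /ds_dist; case: eqP => [->|_]; last by rewrite subr0.
  by rewrite eqxx /= addn0 natrD; ring.
rewrite (eq_bigr _ (fun s _ => E s)) sumrB -big_mkcond big_pred1_eq.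
rewrite !big_sumType big_bool /= -!mulr_suml -/A -/B -/P -/Q.
by case: (hub t); case: (pendant t) => /=; ring.
Qed.

Lemma double_star_eigen (R : realFieldType) (a b : nat) :
  (exists w : double_star a b -> R, (exists s, w s != 0) /\
    forall t, \sum_s w s * (ds_dist s t)%:R = -1 * w t) <->
  (a = 0 /\ b = 0 \/ a = 2 /\ b = 2)%N.
Proof.
split=> [[w [[s ws] wE]]|[[-> ->]|[-> ->]]]; last first.
(* With [a = b = 2], the value 1 on pendant vertices gives [A = B = 2], and then
   [Q + 2 * A = P + 2 * A = 1] forces [P = Q = -3]. *)
- exists (fun s => if s is inl _ then -3 else 1); split.
    by exists (inr (inl ord0)); rewrite oner_neq0.
  move=> t; rewrite sum_ds_dist !sumr_const card_ord.
  by case: t => [[]|[i|i]] /=; ring.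
- exists (fun s => if s is inl true then -1 else 1); split.
    by exists (inl false); rewrite oner_neq0.
  move=> t; rewrite sum_ds_dist !big_ord0.
  by case: t => [[]|[[]|[]]] //=; ring.
have {}wE t := etrans (esym (sum_ds_dist w t)) (wE t).
move: wE; set P := w (inl false); set Q := w (inl true).
set A := \sum_i w _; set B := \sum_j w _ => wE.
have /= eP := wE (inl false); have /= eQ := wE (inl true).
rewrite -/P -/Q in eP eQ.
have AB : A = B by lra.
have PQ : P + Q = - 3 * A by lra.
have eA i : w (inr (inl i)) = Q + 2 * A by have /= := wE (inr (inl i)); lra.
have eB j : w (inr (inr j)) = P + 2 * A by have /= := wE (inr (inr j)); lra.
have sA : A = a%:R * (Q + 2 * A).
  rewrite {1}/A (eq_bigr _ (fun i _ => eA i)) sumr_const card_ord.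
  by rewrite [RHS]mulr_natl.
have sB : A = b%:R * (P + 2 * A).
  rewrite {1}AB {1}/B (eq_bigr _ (fun i _ => eB i)) sumr_const card_ord.
  by rewrite [RHS]mulr_natl.
have [A0|A0] := eqVneq A 0.
  have aQ : a%:R * Q = 0 by rewrite -[RHS]A0 sA A0; ring.
  have bP : b%:R * P = 0 by rewrite -[RHS]A0 sB A0; ring.
  have Q0 : Q != 0.
    apply: contra_neq ws => Q0; have P0 : P = 0 by lra.
    by case: s => [[]|[i|j]]; rewrite ?eA ?eB -/P -/Q ?P0 ?Q0 ?A0; lra.
  have P0 : P != 0 by apply: contra_neq Q0 => P0; lra.
  left; move/eqP: aQ; move/eqP: bP; rewrite !mulf_eq0 (negbTE P0) (negbTE Q0).
  by rewrite !orbF !pnatr_eq0 => /eqP-> /eqP->.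
have /eqP : (a + b)%N%:R * A = (a * b)%N%:R * A.
  rewrite natrD natrM mulrDl {1}sB {2}sA.
  transitivity (a%:R * b%:R * (P + Q + 4 * A)); first by ring.
  by rewrite PQ; ring.
rewrite (inj_eq (mulIf A0)) eqr_nat => /eqP; exact: addn_eq_muln.
Qed.

Lemma double_star_eigenvalue (R : realType) (T : sgraph) (a b : nat) :
  acyclic T -> isomorphic T (double_star a b) ->
  eigenvalue (distance_matrix R T) (-1) <->
  (a = 0 /\ b = 0 \/ a = 2 /\ b = 2)%N.
Proof.
move=> acyc /isomorphic_sym[f f_bij f_adj].
have f_dist := double_star_dist acyc (bij_inj f_bij) f_adj.
rewrite -(double_star_eigen R) eigenvalue_distance_matrix.
have [g fK gK] := f_bij.
have sumE (w : T -> R) t : \sum_x w x * (dist x (f t))%:R =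
    \sum_s w (f s) * (ds_dist s t)%:R.
  rewrite (reindex f) /=; last exact: (onW_bij _ f_bij).
  by apply: eq_bigr => s _; rewrite f_dist.
split=> [] [w [[x wx] wE]].
  exists (w \o f); split; first by exists (g x); rewrite /= gK.
  by move=> t; rewrite -sumE wE.
exists (w \o g); split; first by exists (f x); rewrite /= fK.
move=> y; rewrite -[y in LHS]gK sumE -wE /=.
by apply: eq_bigr => s _; rewrite fK.
Qed.

End Spectrum.

Theorem mainTheorem4 (R : realType) (T : sgraph)
    (tree_T : is_tree T) (diam_T : diameter T <= 3) :
  eigenvalue (distance_matrix R T) (-1)%R <->
  (isomorphic T (path_graph 2) \/ isomorphic T (double_star 2 2)).
Proof.
have [[_ conn] acyc] := tree_T.
split=> [eig|[isoT|isoT]]; last first.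
- by apply/(double_star_eigenvalue R acyc isoT); right.
- have isoT' := isomorphic_trans isoT path2_double_star.
  by apply/(double_star_eigenvalue R acyc isoT'); left.
have [/existsP[u /existsP[v uv]]|/existsPn no_edge] :=
    boolP [exists u : T, [exists v, adj u v]].
  have [a [b isoT]] := small_tree_double_star tree_T diam_T uv.
  have [[a0 b0]|[a2 b2]] := (double_star_eigenvalue R acyc isoT).1 eig.
    left; apply: isomorphic_trans (isomorphic_sym path2_double_star).
    by rewrite a0 b0 in isoT.
  by right; rewrite a2 b2 in isoT.
have eqT (x y : T) : x = y.
  have /connectP[[|z p] /= path_p ->] // := conn x y.
  by case/andP: path_p => xz _; have /existsPn/(_ z) := no_edge x; rewrite xz.
have dist0 (x y : T) : dist x y = 0%N.
  by rewrite (eqT y x) (@acyclic_dist _ acyc x x [::]) // /is_path /= eqxx.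
have /eigenvalue_distance_matrix[w [[x wx] wE]] := eig.
have := wE x; rewrite big1 => [|y _]; last by rewrite dist0 mulr0.
by move/eqP; rewrite mulN1r eq_sym oppr_eq0 (negbTE wx).
Qed.
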